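(* Let $n\ge 2$, let $u,w\in\mathbb{N}$ and $v\in\mathbb{Z}$, where $n\mid v$ implies $uw=0$. If $\mathbf{x}\in\mathcal{L}_v$ but $\mathbf{x}\notin\mathcal{B}_v^{u,w}$, then there exists $\mathbf{z}\in\mathcal{L}_0$ such that $\mathbf{x}+\mathbf{z}\in\mathcal{B}_v^{u,w}$ and $|\eta_{u,v,w}(\mathbf{x}+\mathbf{z})|\le|\eta_{u,v,w}(\mathbf{x})|$. Consequently, if $\mathbf{x}\in\mathcal{B}_v^{u,w}$ is minimal, in the sense that $|\eta_{u,v,w}(\mathbf{x})|\le|\eta_{u,v,w}(\mathbf{y})|$ for all $\mathbf{y}\in\mathcal{B}_v^{u,w}$, then the word $\eta_{u,v,w}(\mathbf{x})$ is geodesic in $BS(1,n)$ with respect to the generating set $\{a,t\}$.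
   Context: $BS(1,n)=\langle t,a\mid tat^{-1}=a^n\rangle$; $\mathbb{N}=\{0,1,2,\dots\}$. For a finitely supported integer sequence $\mathbf{x}=(x_0,x_1,\dots)\in\bigoplus_{i\in\mathbb{N}}\mathbb{Z}$ put $\Sigma(\mathbf{x})=\sum_i x_in^i$, and for $v\in\mathbb{Z}$ let $\mathcal{L}_v=\{\mathbf{x}:\Sigma(\mathbf{x})=v\}$. Let $k_{\mathbf{x}}$ be the index of the last nonzero coordinate of $\mathbf{x}$ (with $k_{\mathbf{0}}=0$). For $u,w\in\mathbb{N}$, $v\in\mathbb{Z}$ and $\mathbf{x}\in\mathcal{L}_v$, writing $k=k_{\mathbf{x}}$, define the word $\eta_{u,v,w}(\mathbf{x})$ in $a^{\pm1},t^{\pm1}$ (it represents $t^{-u}a^vt^w$) by - $t^{-u}a^{x_0}ta^{x_1}\cdots ta^{x_k}t^{w-k}$ if $k\le w$ or if $u\le w<k$; - $t^{k-u}a^{x_k}t^{-1}a^{x_{k-1}}\cdots t^{-1}a^{x_0}t^{w}$ if $w<k\le u$ or if $w<u<k$. $|\cdot|$ denotes the length of the word as written (sum of absolute values of exponents, no cancellation). The box $\mathcal{B}_v^{u,w}\subseteq\mathcal{L}_v$ is the set of $\mathbf{x}\in\mathcal{L}_v$ such that: (1) $|x_i|\le\lfloor n/2\rfloor$ for all $i<k_{\mathbf{x}}$; (2) if $k_{\mathbf{x}}<\max(u,w)$ then $|x_{k_{\mathbf{x}}}|\le\lfloor n/2\rfloor$; (3) if $k_{\mathbf{x}}\ge\max(u,w)$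 then $|x_{k_{\mathbf{x}}}|\le\lfloor n/2\rfloor+1$ when $n\ge3$, and $|x_{k_{\mathbf{x}}}|\le\lfloor n/2\rfloor+2$ when $n=2$. *)

(* Defs.v *)
From mathcomp Require Import all_boot all_order all_algebra.

Set Implicit Arguments.
Unset Strict Implicit.
Unset Printing Implicit Defensive.

Import Order.TTheory GRing.Theory Num.Theory.
Local Open Scope ring_scope.

Inductive bs_gen := gen_a | gen_t.

(* The letter (g, false) is g and (g, true) is g^-1; words are not reduced, so
   [size] is the length of a word as written. *)
Definition word := seq (bs_gen * bool).

Definition gpow (g : bs_gen) (m : int) : word := nseq `|m|%N (g, m < 0).

(* [bs_eq n] is the congruence on the free monoid on {a, a^-1, t, t^-1} whose
   quotient is the group BS(1,n) = < t, a | t a t^-1 = a^n >. *)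
Inductive bs_eq (n : nat) : word -> word -> Prop :=
| bs_eq_refl W : bs_eq n W W
| bs_eq_sym V W : bs_eq n V W -> bs_eq n W V
| bs_eq_trans U V W : bs_eq n U V -> bs_eq n V W -> bs_eq n U W
| bs_eq_cat V V' W W' :
    bs_eq n V V' -> bs_eq n W W' -> bs_eq n (V ++ W) (V' ++ W')
| bs_eq_inv g s : bs_eq n [:: (g, s); (g, ~~ s)] [::]
| bs_eq_rel :
    bs_eq n (gpow gen_t 1 ++ gpow gen_a 1 ++ gpow gen_t (-1)) (gpow gen_a n%:Z).

Definition geodesic (n : nat) (W : word) : Prop :=
  forall W' : word, bs_eq n W W' -> (size W <= size W')%N.

(* Finitely supported integer sequences are encoded as {poly int}: the
   coefficient x`_i is the coordinate x_i (zero beyond the support), + is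
   coordinatewise, and [size] is one more than the index of the last nonzero
   coordinate, or 0 for the zero sequence. *)
Notation fsseq := {poly int}.

Definition Sigma (n : nat) (x : fsseq) : int :=
  \sum_(i < size x) x`_i * n%:Z ^+ i.

Definition inL (n : nat) (v : int) (x : fsseq) : Prop := Sigma n x = v.

Definition lastidx (x : fsseq) : nat := (size x).-1.

(* The else branch covers exactly the cases w < k <= u and w < u < k.
   The word depends on v only through the constraint inL n v x. *)
Definition eta_word (u w : nat) (x : fsseq) : word :=
  let k := lastidx x in
  if ((k <= w) || (u <= w < k))%N then
    gpow gen_t (- u%:Z) ++ gpow gen_a x`_0
      ++ flatten [seq gpow gen_t 1 ++ gpow gen_a x`_i | i <- iota 1 k]
      ++ gpow gen_t (w%:Z - k%:Z)
  else
    gpow gen_t (k%:Z - u%:Z) ++ gpow gen_a x`_k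
      ++ flatten [seq gpow gen_t (-1) ++ gpow gen_a x`_i | i <- rev (iota 0 k)]
      ++ gpow gen_t w%:Z.

Definition in_box (n u w : nat) (v : int) (x : fsseq) : Prop :=
  let k := lastidx x in
  [/\ inL n v x,
      forall i : nat, (i < k)%N -> (`|(x`_i)%R| <= n./2)%N,
      (k < maxn u w)%N -> (`|(x`_k)%R| <= n./2)%N
    & (maxn u w <= k)%N ->
        ((3 <= n)%N -> (`|(x`_k)%R| <= n./2 + 1)%N) /\
        (n = 2%N -> (`|(x`_k)%R| <= n./2 + 2)%N)].

(* Main.v *)
Require Import Defs.
From mathcomp Require Import all_boot all_order all_algebra.
From mathcomp Require Import zify ring.

Set Implicit Arguments.
Unset Strict Implicit.
Unset Printing Implicit Defensive.

Import Order.TTheory GRing.Theory Num.Theory.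
Local Open Scope ring_scope.

(** Write k for the last index of x, M for the maximum of u and w, and L1 for
    the sum of the absolute values of the digits.  In all its cases the length
    of [eta_word u w x] is L1 + u + w + 2 max(0, k - M) ([size_eta]); both
    halves of the theorem are read off from this formula.

    Boxing.  Replacing the digits (x_i, x_(i+1)) by (x_i - c n, x_(i+1) + c)
    preserves the value Sigma.  A digit exceeding n/2 admits such a carry,
    with c = 1 or -1, that does not increase L1.  Only carrying out of a top
    digit at an index k >= M lengthens the word, by the two extra letters t
    needed to climb one level higher; the slack granted to that digit by the
    box is exactly what makes the carry gain at least 2 in L1 whenever the
    digit is too large (for n = 2 this takes c = 2 or -2).  The process stops,
    because each carry strictly lowers the sum of (N - i) |x_i|, for a level N
    that is out of reach of all words no longer than the initial one
    ([box_representative]).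

    Geodesics.  Let t act on the rationals as multiplication by n and a as
    translation by 1.  A word then determines a height (its exponent sum in t)
    and a translation part, both invariants of the group element
    ([bs_eq_invariant]).  For an arbitrary word W, collect its letters a
    according to the height at which they are read: if the path of heights
    stays between -p and q, then W has translation part n^(-p) Sigma(y), where
    y has digits up to index p + q, and the length of W is at least
    L1(y) + 2 (p + q) - |height| ([word_profile]).  If W represents
    t^(-u) a^v t^w, then p < u is excluded: it forces n | v, hence u w = 0,
    hence w = 0, and a path ending at height -u descends to -u.  If p > u,
    then Sigma(y) is divisible by n^(p - u) and the low digits can be carried
    up without increasing L1 ([divide_sequence]).  So every word representing
    the element is at least as long as [eta_word u w y] for some y with
    Sigma(y) = v ([eta_le_word]), which boxing compares with the box. *)

(** * Weighted norms of integer sequences *)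

Lemma SigmaE (n : nat) (x : fsseq) : Sigma n x = x.[n%:Z].
Proof. by rewrite /Sigma horner_coef. Qed.

(** The weight [f] is constant for the number of letters a in a word, and
    decreasing for the quantity that bounds the number of carries; [N] is kept
    separate from the size of [x] so that sequences of different lengths can
    be compared. *)
Definition wnorm (f : nat -> nat) (N : nat) (x : fsseq) : nat :=
  (\sum_(i < N) f i * `|(x`_i)%R|)%N.

Definition l1norm (x : fsseq) : nat := wnorm (fun=> 1%N) (size x) x.

Lemma l1normE (x : fsseq) (N : nat) :
  (size x <= N)%N -> l1norm x = wnorm (fun=> 1%N) N x.
Proof.
move=> le_xN; rewrite /l1norm /wnorm (big_ord_widen N (fun i => 1 * `|(x`_i)%R|)%N) //.
rewrite big_mkcond /=; apply: eq_bigr => i _; case: ltnP => // le_xi.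
by rewrite nth_default.
Qed.

Lemma abszD_le (a b : int) : (`|(a + b)%R| <= `|a| + `|b|)%N.
Proof. lia. Qed.

Lemma wnormD f N (x y : fsseq) : (wnorm f N (x + y)%R <= wnorm f N x + wnorm f N y)%N.
Proof.
rewrite /wnorm -big_split /=; apply: leq_sum => i _.
rewrite coefD -mulnDr leq_mul2l; apply/orP; right.
exact: abszD_le.
Qed.

Lemma wnorm_monomial f N (c : int) i : (wnorm f N (c *: 'X^i)%R <= f i * `|c|)%N.
Proof.
rewrite /wnorm; case: (ltnP i N) => [lt_iN|le_Ni].
  rewrite (bigD1 (Ordinal lt_iN)) //= coefZ coefXn eqxx mulr1 big1 ?addn0 //.
  move=> j ne_ji; rewrite coefZ coefXn; case: eqP => [eq_ji|_]; last by rewrite mulr0 muln0.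
  by case/eqP: ne_ji; apply: val_inj.
rewrite big1 // => j _; rewrite coefZ coefXn; case: eqP => [eq_ji|_].
  by have := ltn_ord j; rewrite eq_ji ltnNge le_Ni.
by rewrite mulr0 muln0.
Qed.

Lemma l1normD x y : (l1norm (x + y)%R <= l1norm x + l1norm y)%N.
Proof.
have sx := leq_maxl (size x) (size y); have sy := leq_maxr (size x) (size y).
by rewrite (l1normE (size_polyD x y)) (l1normE sx) (l1normE sy) wnormD.
Qed.

Lemma l1norm_monomial c i : (l1norm (c *: 'X^i)%R <= `|c|)%N.
Proof. by rewrite -[X in (_ <= X)%N]mul1n; apply: wnorm_monomial. Qed.

Lemma l1norm_cons (g : fsseq) (c : int) : l1norm (g * 'X + c%:P) = (`|c| + l1norm g)%N.
Proof.
have sz : (size (g * 'X + c%:P)%R <= (size g).+1)%N.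
  by rewrite -cons_poly_def size_cons_poly; case: ifP.
rewrite (l1normE sz) /wnorm big_ord_recl mul1n /=.
rewrite coefD coefMX coefC add0r; congr addn.
by apply: eq_bigr => i _; rewrite coefD coefMX coefC /= addr0.
Qed.

(** * Carries *)

Definition carry (n : nat) (x : fsseq) (i : nat) (c : int) : {poly int} :=
  x + (- (c * n%:Z)) *: 'X^i + c *: 'X^(i.+1).

Lemma Sigma_carry n x i c : Sigma n (carry n x i c) = Sigma n x.
Proof. by rewrite !SigmaE /carry !hornerE exprS; ring. Qed.

Lemma size_monomial (c : int) i : (size (c *: 'X^i)%R <= i.+1)%N.
Proof. by rewrite (leq_trans (size_scale_leq _ _)) ?size_polyXn. Qed.

Lemma size_carry n x i c : (size (carry n x i c) <= maxn (size x) i.+2)%N.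
Proof.
rewrite /carry (leq_trans (size_polyD _ _)) // geq_max; apply/andP; split.
  rewrite (leq_trans (size_polyD _ _)) // geq_max leq_maxl /=.
  by apply: leq_trans (size_monomial _ _) _; lia.
by apply: leq_trans (size_monomial _ _) _; lia.
Qed.

(** Only the digits [i] and [i.+1] change, and the second by at most [c]; the
    subtracted digit is put on the left to avoid subtraction in [nat]. *)
Lemma wnorm_carry f N n x i c : (i < N)%N ->
  (wnorm f N (carry n x i c) + f i * `|(x`_i)%R|
     <= wnorm f N x + f i * `|(x`_i - c * n%:Z)%R| + f i.+1 * `|c|)%N.
Proof.
move=> lt_iN; rewrite /carry.
set x' := x + _.
have h1 := wnormD f N x' (c *: 'X^(i.+1)).
have h2 := wnorm_monomial f N c i.+1.
suff h3 : (wnorm f N x' + f i * `|(x`_i)%R|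
           = wnorm f N x + f i * `|(x`_i - c * n%:Z)%R|)%N by lia.
rewrite /wnorm (bigD1 (Ordinal lt_iN)) //= [in RHS](bigD1 (Ordinal lt_iN)) //=.
rewrite [X in (_ + X + _)%N = _](eq_bigr (fun j : 'I_N => (f j * `|(x`_j)%R|)%N)).
  by rewrite /x' coefD coefZ coefXn eqxx mulr1 addnC addnA addnAC.
move=> j ne_ji; rewrite /x' coefD coefZ coefXn; case: eqP => [eq_ji|_].
  by case/eqP: ne_ji; apply: val_inj.
by rewrite mulr0 addr0.
Qed.

Lemma l1norm_carry n x i c :
  (l1norm (carry n x i c) + `|(x`_i)%R| <= l1norm x + `|(x`_i - c * n%:Z)%R| + `|c|)%N.
Proof.
rewrite (l1normE (size_carry n x i c)) (l1normE (leq_maxl (size x) i.+2)).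
have := @wnorm_carry (fun=> 1%N) (maxn (size x) i.+2) n x i c; lia.
Qed.

(** * The length of eta *)

Lemma size_gpow g m : size (gpow g m) = `|m|%N.
Proof. by rewrite size_nseq. Qed.

Lemma l1norm_lastidx x : l1norm x = (\sum_(i < (lastidx x).+1) `|(x`_i)%R|)%N.
Proof.
rewrite (@l1normE _ (lastidx x).+1) /lastidx; last by case: (size x).
by apply: eq_bigr => i _; rewrite mul1n.
Qed.

(** Measured from level [-u], the path of heights starts at [u], ends at [w]
    and visits [0] and the last index.  Going from [u] to [w] through [0] takes
    [u + w] steps, and every level above [maxn u w] costs one step up and one
    step down. *)
Lemma size_eta u w x :
  size (eta_word u w x) = (l1norm x + (u + w) + (lastidx x - maxn u w).*2)%N.
Proof.
rewrite l1norm_lastidx /eta_word; set k := lastidx x.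
case: ifP => kuw; rewrite !size_cat !size_gpow size_flatten /shape -map_comp sumnE big_map.
  rewrite (eq_bigr (fun i => 1 + `|(x`_i)%R|)%N); last first.
    by move=> i _; rewrite /= size_gpow.
  rewrite big_split /= sum1_size size_iota big_ord_recl.
  rewrite (iotaDl 1 0 k) big_map -[in iota 0 k](subn0 k) -/(index_iota 0 k).
  rewrite big_mkord; set s := (\sum_(i < k) _)%N.
  rewrite [nat_of_ord ord0]/=; by move: s `|(x`_0)%R|%N => s c; lia.
rewrite (eq_bigr (fun i => 1 + `|(x`_i)%R|)%N); last first.
  by move=> i _; rewrite /= size_gpow.
rewrite big_split /= sum1_size size_rev size_iota.
rewrite (perm_big (iota 0 k)) /=; last by rewrite perm_rev.
rewrite -[in iota 0 k](subn0 k) -/(index_iota 0 k) big_mkord big_ord_recr /=.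
set s := (\sum_(i < k) _)%N.
by move: s `|(x`_k)%R|%N => s c; lia.
Qed.

(** * Reduction to the box *)

(** For positive [m], either [m] is closer to [n] than to [0] or it lies beyond
    [n], so subtracting [n] gains at least the unit that the carry may add to
    the next digit; negative [m] are symmetric. *)
Lemma carry_digit n (m : int) : (0 < n)%N -> (n./2 < `|m|)%N ->
  exists2 c : int, `|c|%N = 1%N & (`|(m - c * n%:Z)%R| + 1 <= `|m|)%N.
Proof.
move=> n_gt0 big_m; exists (if 0 <= m then 1 else -1); first by case: ifP.
by case: ifP => sg; rewrite ?mulN1r ?mul1r; lia.
Qed.

(** The margin of 2 pays for the new level that the carry opens. *)
Lemma carry_top n (m : int) : (3 <= n)%N ->
  (n./2 + 1 < `|m|)%N ->
  exists2 c : int, c != 0 & (`|(m - c * n%:Z)%R| + `|c| + 2 <= `|m|)%N.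
Proof.
move=> n3 big_m; exists (if 0 <= m then 1 else -1); first by case: ifP.
by case: ifP => sg; rewrite ?mulN1r ?mul1r; lia.
Qed.

(** For [n = 2] a carry of one unit gains only 1 in absolute value, whereas
    [4 = 2 * 2] trades 4 for 2; this is why the box tolerates a top digit 3. *)
Lemma carry_top2 (m : int) : (3 < `|m|)%N ->
  exists2 c : int, c != 0 & (`|(m - c * 2%:Z)%R| + `|c| + 2 <= `|m|)%N.
Proof.
move=> big_m; exists (if 0 <= m then 2 else -2); first by case: ifP.
by case: ifP => sg; lia.
Qed.

(** The third condition, for [c != 0], makes every weighted norm with strictly
    decreasing weights drop, even when the length of the word stays the same. *)
Definition improving (n u w : nat) (x : fsseq) (i : nat) (c : int) : Prop :=
  [/\ (i <= lastidx x)%N, c != 0,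
      (`|(x`_i - c * n%:Z)%R| + `|c| <= `|(x`_i)%R|)%N &
      (size (eta_word u w (carry n x i c)) <= size (eta_word u w x))%N].

(** A carry from an index below [k] or below [maxn u w] opens no level that
    has to be paid for. *)
Lemma improving_low n u w (x : fsseq) i :
  (0 < n)%N -> (n./2 < `|(x`_i)%R|)%N -> (i <= lastidx x)%N ->
  (i < maxn (lastidx x) (maxn u w))%N -> exists c, improving n u w x i c.
Proof.
move=> n_gt0 big_xi le_ik lt_iK; have [c c1 dec] := carry_digit n_gt0 big_xi.
exists c; split=> //; [lia|lia|].
move: (size_carry n x i c) (l1norm_carry n x i c) dec.
rewrite !size_eta /lastidx c1 in le_ik lt_iK *.
by move: `|(x`_i)%R|%N `|(x`_i - _)%R|%N => a b; lia.
Qed.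

Lemma improving_last n u w (x : fsseq) c : c != 0 ->
  (`|(x`_(lastidx x) - c * n%:Z)%R| + `|c| + 2 <= `|(x`_(lastidx x))%R|)%N ->
  improving n u w x (lastidx x) c.
Proof.
move=> c0 dec; split=> //; first by apply: leq_trans dec; rewrite leq_addr.
move: (size_carry n x (lastidx x) c) (l1norm_carry n x (lastidx x) c) dec.
rewrite !size_eta; move: `|(x`_(lastidx x))%R|%N `|(x`_(lastidx x) - _)%R|%N => a b.
by rewrite /lastidx; lia.
Qed.

Lemma box_or_improving n u w v x : (2 <= n)%N -> inL n v x ->
  in_box n u w v x \/ exists i c, improving n u w x i c.
Proof.
move=> n2 xv; set k := lastidx x; have n_gt0 : (0 < n)%N by lia.
case: (boolP [exists i : 'I_k, n./2 < `|(x`_i)%R|]%N) => [/existsP[i big_xi]|].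
  right; exists i; apply: improving_low => //; have := ltn_ord i; rewrite -/k; lia.
rewrite negb_exists => /forallP low.
have {}low i : (i < k)%N -> (`|(x`_i)%R| <= n./2)%N.
  by move=> lt_ik; have := low (Ordinal lt_ik); rewrite -leqNgt.
case: (ltnP k (maxn u w)) => [lt_kM|le_Mk].
  case: (leqP `|(x`_k)%R|%N n./2) => [le_xk|big_xk].
    by left; split=> //; rewrite -/k => ?; lia.
  by right; exists k; apply: improving_low => //; lia.
case: (ltnP 2 n) => [n3|le_n2].
  case: (leqP `|(x`_k)%R|%N (n./2 + 1)) => [le_xk|big_xk].
    by left; split=> //; rewrite -/k => ?; [lia|split=> // ?; lia].
  have [c c0 dec] := carry_top n3 big_xk.
  by right; exists k, c; apply: improving_last.
have n_eq2 : n = 2%N by lia.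
case: (leqP `|(x`_k)%R|%N 3) => [le_xk|big_xk].
  by left; split=> //; rewrite -/k => ?; [lia|split=> [|_]; [lia|rewrite n_eq2]].
have [c c0 dec] := carry_top2 big_xk.
by right; exists k, c; apply: improving_last => //; rewrite n_eq2.
Qed.

(** Equal lengths are possible along a chain of carries, so termination comes
    from the weight [N - i] on the digit [i] and not from the length. *)
Lemma box_representative n u w v x : (2 <= n)%N -> inL n v x ->
  exists2 y, in_box n u w v y
    & (size (eta_word u w y) <= size (eta_word u w x))%N.
Proof.
move=> n2; set N := (maxn u w + size (eta_word u w x)).+1.
(* As the length is at least 2 (k - maxn u w), the last index k of any
   sequence met in the process stays below N. *)
pose weight := wnorm (fun i => N - i)%N N.
suff H m : forall y, (weight y < m)%N -> inL n v y ->
    (size (eta_word u w y) <= size (eta_word u w x))%N ->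
    exists2 z, in_box n u w v z
      & (size (eta_word u w z) <= size (eta_word u w x))%N.
  by move=> xv; apply: (H (weight x).+1 x).
elim: m => // m IHm y lt_ym yv le_yx.
have [y_box|[i [c [le_ik c0 dec le_eta]]]] := @box_or_improving n u w v y n2 yv.
  by exists y.
apply: (IHm (carry n y i c)).
- have lt_iN : (i < N)%N.
    by move: le_yx; rewrite size_eta /N; lia.
  have := @wnorm_carry (fun i => N - i)%N N n y i c lt_iN; rewrite -/weight.
  move: lt_ym dec; rewrite /weight.
  set d := `|(y`_i - _)%R|%N; set e := `|(y`_i)%R|%N => ? ?.
  suff : ((N - i) * d + (N - i.+1) * `|c| < (N - i) * e)%N by lia.
  have : ((N - i) * (d + `|c|) <= (N - i) * e)%N by rewrite leq_mul2l; apply/orP; right.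
  rewrite mulnDr; apply: leq_trans; rewrite ltn_add2l ltn_mul2r; lia.
- by rewrite /inL Sigma_carry.
- exact: leq_trans le_eta le_yx.
Qed.

(** * Height and translation part of a word *)

Definition letter_sign (s : bool) : int := if s then -1 else 1.

Fixpoint height (W : word) : int :=
  match W with
  | [::] => 0
  | (gen_a, _) :: W' => height W'
  | (gen_t, s) :: W' => letter_sign s + height W'
  end.

(** The value at 0 of the affine map of the rational line obtained by letting a
    act as translation by 1 and t as multiplication by [n]. *)
Fixpoint aval (n : nat) (W : word) : rat :=
  match W with
  | [::] => 0
  | (gen_a, s) :: W' => (letter_sign s)%:~R + aval n W'
  | (gen_t, s) :: W' => n%:R ^ letter_sign s * aval n W'
  end.

Lemma height_cat V W : height (V ++ W) = height V + height W.
Proof. by elim: V => [|[[] s] V IHV] //=; rewrite ?add0r // IHV addrA. Qed.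

Lemma height_gpow_a m : height (gpow gen_a m) = 0.
Proof. by rewrite /gpow; elim: `|m|%N. Qed.

Lemma height_gpow_t m : height (gpow gen_t m) = m.
Proof.
have height_nseq s k : height (nseq k (gen_t, s)) = letter_sign s * k%:Z.
  elim: k => [|k IHk] /=; first by rewrite mulr0.
  by rewrite IHk -addn1 PoszD; ring.
by rewrite height_nseq /letter_sign; case: ifP; lia.
Qed.

Lemma aval_gpow_a n m : aval n (gpow gen_a m) = m%:~R.
Proof.
rewrite /gpow.
suff H s k : aval n (nseq k (gen_a, s)) = (letter_sign s * k%:Z)%:~R.
  by rewrite H; congr (_ %:~R); rewrite /letter_sign; case: ifP; lia.
elim: k => [|k IHk] /=; first by rewrite mulr0.
by rewrite IHk -intrD; congr (_ %:~R); rewrite -addn1 PoszD; ring.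
Qed.

Lemma aval_gpow_t n m : aval n (gpow gen_t m) = 0.
Proof. by rewrite /gpow; elim: `|m|%N => //= k ->; rewrite mulr0. Qed.

Lemma natr_rat_neq0 n : (0 < n)%N -> n%:R != 0 :> rat.
Proof. by move=> n_gt0; rewrite pnatr_eq0 -lt0n. Qed.

(** The composition law of affine maps. *)
Lemma aval_cat n V W : (0 < n)%N -> aval n (V ++ W) = aval n V + n%:R ^ height V * aval n W.
Proof.
move=> n_gt0; elim: V => [|[[] s] V IHV] /=; first by rewrite add0r mul1r.
  by rewrite IHV addrA.
by rewrite IHV expfzDr ?natr_rat_neq0 // mulrDr mulrA.
Qed.

(** Together, the height and the translation part describe the affine
    representation of the group. *)
Lemma bs_eq_invariant n V W : (0 < n)%N -> bs_eq n V W -> height V = height W /\ aval n V = aval n W.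
Proof.
move=> n_gt0; elim=> {V W} //.
- by move=> V W _ [-> ->].
- by move=> U V W _ [-> ->].
- by move=> V V' W W' _ [hV aV] _ [hW aW]; rewrite !height_cat !aval_cat // hV aV hW aW.
- case=> s /=; split=> //; rewrite ?addr0.
  + by rewrite -intrD; case: s.
  + by case: s.
  + by rewrite !mulr0.
split.
  by rewrite !height_cat height_gpow_a !height_gpow_t height_gpow_a.
rewrite !aval_cat // !aval_gpow_a !aval_gpow_t !height_gpow_t height_gpow_a.
by rewrite add0r mulr0 addr0 expr1z mulr1.
Qed.

Lemma aval_eta n u w x : (0 < n)%N ->
  aval n (eta_word u w x) = n%:R ^ (- u%:Z) * (Sigma n x)%:~R.
Proof.
move=> n_gt0.
have -> : (Sigma n x)%:~R =
    \sum_(i < (lastidx x).+1) (x`_i)%:~R * n%:R ^ i%:Z :> rat.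
  rewrite SigmaE (@horner_coef_wide _ (lastidx x).+1); last first.
    by rewrite /lastidx; case: (size x).
  by rewrite rmorph_sum; apply: eq_bigr => i _; rewrite rmorphM rmorphXn.
rewrite /eta_word; set k := lastidx x; have n0 := natr_rat_neq0 n_gt0.
case: ifP => _; rewrite !aval_cat // !aval_gpow_t !aval_gpow_a !height_gpow_t height_gpow_a;
  rewrite add0r expr0z mul1r mulr0 addr0.
  rewrite big_ord_recl /= expr0z mulr1; congr (_ * (_ + _)).
  suff H j : aval n (flatten [seq gpow gen_t 1 ++ gpow gen_a x`_i | i <- iota j k]) =
     \sum_(i < k) (x`_(j + i))%:~R * n%:R ^ i.+1%:Z.
    by rewrite H; apply: eq_bigr => i _.
  elim: k j => [|k IHk] j /=; first by rewrite big_ord0.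
  rewrite big_ord_recl /= addn0 aval_cat // IHk aval_gpow_a height_gpow_a expr0z mul1r.
  rewrite expr1z mulrDr mulrC; congr (_ + _); rewrite mulr_sumr.
  apply: eq_bigr => i _; rewrite /bump /= addnS -addSn.
  by rewrite -[in RHS]exprnP exprS exprnP; ring.
have -> : aval n (flatten [seq gpow gen_t (-1) ++ gpow gen_a x`_i | i <- rev (iota 0 k)]) =
     \sum_(i < k) (x`_i)%:~R * n%:R ^ (i%:Z - k%:Z).
  elim: k => [|k IHk]; first by rewrite big_ord0.
  rewrite -addn1 iotaD rev_cat add0n /= aval_cat // IHk addn1 aval_gpow_a height_gpow_a.
  rewrite expr0z mul1r mulrDr big_ord_recr /= addrC mulr_sumr; congr (_ + _).
    by rewrite mulrC; congr (_ * _ ^ _); lia.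
  by apply: eq_bigr => i _; rewrite mulrCA -expfzDr //; congr (_ * _ ^ _); lia.
rewrite big_ord_recr /= addrC expfzDr // [n%:R ^ k%:Z * _]mulrC -mulrA; congr (_ * _).
rewrite mulrDr mulr_sumr [_ * (x`_k)%:~R]mulrC; congr (_ + _).
by apply: eq_bigr => i _; rewrite mulrCA -expfzDr //; congr (_ * _ ^ _); lia.
Qed.

Lemma height_eta u w x : height (eta_word u w x) = w%:Z - u%:Z.
Proof.
rewrite /eta_word; set k := lastidx x.
have H (s : int) r : height (flatten [seq gpow gen_t s ++ gpow gen_a x`_i | i <- r]) = s * (size r)%:Z.
  elim: r => [|i r IHr] /=; first by rewrite mulr0.
  by rewrite !height_cat IHr height_gpow_t height_gpow_a -[(size r).+1]addn1 PoszD; ring.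
case: ifP => _; rewrite !height_cat H !height_gpow_t height_gpow_a ?size_rev size_iota; lia.
Qed.

(** * Lower bound for the length of an arbitrary word *)

(** The levels [-p] and [q] are the extreme heights of the path of [W].
    Prepending a letter t or t^-1 shifts the window and extends it to contain
    the new starting point 0.  A window that grows does so because its end was
    0, in which case the final height lies on the side that makes
    [2 (p + q) - |height|] grow by one only. *)
Lemma word_profile n W : (0 < n)%N -> exists p q : nat, exists y : fsseq,
  [/\ aval n W = n%:R ^ (- p%:Z) * (Sigma n y)%:~R,
      (size y <= (p + q).+1)%N,
      - p%:Z <= height W <= q%:Z
    & (l1norm y + (p + q).*2 <= size W + `|height W|)%N].
Proof.
move=> n_gt0; have n0 := natr_rat_neq0 n_gt0.
elim: W => [|[[] s] W [p [q [y [aW sy hW cost]]]]].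
- exists 0%N, 0%N, 0; split=> //=.
  + by rewrite SigmaE horner0 mulr0.
  + by rewrite size_poly0.
  + by rewrite /l1norm /wnorm size_poly0 big_ord0.
- exists p, q, (y + letter_sign s *: 'X^p); split=> //=.
  + rewrite aW !SigmaE !hornerE rmorphD rmorphM rmorphXn /= mulrDr addrC.
    by congr (_ + _); rewrite mulrCA exprnP -expfzDr // addNr mulr1.
  + rewrite (leq_trans (size_polyD _ _)) // geq_max sy.
    by apply: leq_trans (size_monomial _ _) _; rewrite ltnS leq_addr.
  + apply: (@leq_trans (l1norm y + 1 + (p + q).*2)%N); last by rewrite addn1 !addSn ltnS.
    rewrite leq_add2r (leq_trans (l1normD _ _)) // leq_add2l.
    by apply: leq_trans (l1norm_monomial _ _) _; case: (s).
case: s.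
  exists p.+1, q.-1, y; split=> /=; [|apply: leq_trans sy _; lia|lia|lia].
  by rewrite aW mulrA -expfzDr //; congr (_ ^ _ * _); lia.
case: p aW sy hW cost => [|p] aW sy hW cost.
  exists 0%N, q.+1, (y * 'X + 0%:P); split=> /=.
  + rewrite aW !SigmaE !hornerE rmorphM /=.
    by rewrite expr1z expr0z mulr1 mulrC.
  + rewrite addr0 (leq_trans (size_polyMleq _ _)) // size_polyX addn2 /=.
    by move: sy; rewrite ltnS !add0n.
  + lia.
  + by rewrite l1norm_cons; lia.
exists p, q.+1, y; split=> /=; [|apply: leq_trans sy _; lia|lia|lia].
by rewrite aW mulrA -expfzDr //; congr (_ ^ _ * _); lia.
Qed.

(** The lowest digit is a multiple [e * n], because [n] divides the whole sum;
    carrying [e] up and dropping the resulting zero divides the value by [n].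
    The sequence may shrink to a single digit but the bound on its size stays
    at least one, which leaves room for [e]. *)
Lemma divide_sequence n d s (v : int) (y : fsseq) : (0 < n)%N ->
    Sigma n y = n%:Z ^+ d * v -> (size y <= d + s.+1)%N ->
  exists y', [/\ inL n v y', (l1norm y' <= l1norm y)%N & (size y' <= s.+1)%N].
Proof.
move=> n_gt0; elim: d y => [|d IHd] y; first by rewrite mul1r => yv sy; exists y.
elim/poly_ind: y => [|g c _] yv sy.
  apply: (IHd 0); last by rewrite size_poly0.
  move: yv; rewrite !SigmaE !horner0 exprS -mulrA => /esym/eqP.
  by rewrite mulf_eq0 => /orP[|/eqP -> //]; lia.
have [e c_eq] : exists e : int, c = e * n%:Z.
  exists (n%:Z ^+ d * v - g.[n%:Z]); move: yv; rewrite SigmaE !hornerE exprS => yv.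
  by rewrite mulrBl -mulrA mulrC -mulrA [v * _]mulrC -[in LHS](addKr (g.[n%:Z] * n%:Z) c) yv; ring.
have sg : (size g <= d + s.+1)%N.
  by move: sy; rewrite -cons_poly_def size_cons_poly; case: ifP => [/andP[/nilP -> ]|] //.
have [||y' [y'v l1 sy']] := IHd (g + e%:P).
- apply: (@mulIf _ n%:Z); first lia.
  move: yv; rewrite !SigmaE !hornerE c_eq exprS => yv.
  by rewrite mulrDl yv; ring.
- rewrite (leq_trans (size_polyD _ _)) // geq_max sg.
  by apply: leq_trans (size_polyC_leq1 _) _; rewrite addnS.
exists y'; split=> //; apply: leq_trans l1 _.
rewrite l1norm_cons c_eq abszM addnC (leq_trans (l1normD _ _)) // leq_add2l.
by rewrite -alg_polyC -(expr0 'X) (leq_trans (l1norm_monomial _ _)) // leq_pmulr.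
Qed.

(** If the path stays above [-u], the translation part [n^(-u) v] has a smaller
    denominator than expected, so [n] divides [v]; the hypothesis on [u] and
    [w] then makes [-u] the end point of the path, a contradiction.  Otherwise
    the levels below [-u] are redundant. *)
Lemma eta_le_word n u w v W : (0 < n)%N -> ((n%:Z %| v)%Z -> (u * w = 0)%N) ->
    height W = w%:Z - u%:Z -> aval n W = n%:R ^ (- u%:Z) * v%:~R ->
  exists2 y, inL n v y & (size (eta_word u w y) <= size W)%N.
Proof.
move=> n_gt0 huw hW aW.
have [p [q [y [aWy sy range cost]]]] := word_profile W n_gt0.
have n0 := natr_rat_neq0 n_gt0.
have eq_int : n%:Z ^+ u * Sigma n y = n%:Z ^+ p * v.
  apply: (@intr_inj rat); rewrite !rmorphM !rmorphXn /= !exprnP.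
  have -> : n%:R ^ u%:Z * (Sigma n y)%:~R = n%:R ^ (u%:Z + p%:Z) * aval n W :> rat.
    by rewrite aWy mulrA -expfzDr // addrK.
  by rewrite aW mulrA -expfzDr // addrAC addrN add0r.
have le_up : (u <= p)%N.
  rewrite leqNgt; apply/negP => lt_pu.
  suff /huw : (n%:Z %| v)%Z by rewrite hW in range; nia.
  have : n%:Z ^+ p * v = n%:Z ^+ p * (n%:Z ^+ (u - p) * Sigma n y).
    by rewrite -eq_int mulrA -exprD subnKC // ltnW.
  move/mulfI => -> //; last by rewrite expf_eq0; lia.
  by rewrite dvdz_mulr // dvdz_exp //; lia.
have [||y' [y'v l1 sy']] := @divide_sequence n (p - u) (u + q) v y n_gt0.
- apply: (@mulfI _ (n%:Z ^+ u)); first by rewrite expf_eq0; lia.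
  by rewrite eq_int mulrA -exprD subnKC.
- lia.
exists y' => //; rewrite size_eta /lastidx; lia.
Qed.

Theorem lemma3p10 (n : nat) (hn : (2 <= n)%N) (u w : nat) (v : int)
    (huw : (n%:Z %| v)%Z -> (u * w = 0)%N) :
  (forall x : fsseq, inL n v x -> ~ in_box n u w v x ->
     exists z : fsseq,
       [/\ inL n 0 z,
           in_box n u w v (x + z)
         & (size (eta_word u w (x + z)) <= size (eta_word u w x))%N])
  /\
  (forall x : fsseq, in_box n u w v x ->
     (forall y : fsseq, in_box n u w v y ->
        (size (eta_word u w x) <= size (eta_word u w y))%N) ->
     geodesic n (eta_word u w x)).
Proof.
split=> [x xv _|x [xv _ _ _] x_min W' eq_W'].
  have [y y_box le_yx] := @box_representative n u w v x hn xv.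
  exists (y - x); have -> : x + (y - x) = y by rewrite addrC subrK.
  split=> //.
  case: y_box => yv _ _ _; move: xv yv; rewrite /inL !SigmaE !hornerE => -> ->.
  exact: subrr.
have n_gt0 : (0 < n)%N by apply: ltnW.
have [hW' aW'] := bs_eq_invariant n_gt0 eq_W'.
have [||y yv le_yW'] := @eta_le_word n u w v W' n_gt0 huw.
- by rewrite -hW' height_eta.
- by rewrite -aW' aval_eta // xv.
have [z z_box le_zy] := @box_representative n u w v y hn yv.
exact: leq_trans (x_min z z_box) (leq_trans le_zy le_yW').
Qed.
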